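(* Let $G$ be a finite group and let $(\Omega,\leq)$ be a $G$-admissible graded finite poset of rank $m$. Fix an integer $t$ with $0\leq t<m$. Let $X=X_m$ be the top fiber of $\Omega$ and let $D\subseteq X$ be a $t$-design of index $\lambda$, with $b_D=|D|$. Assume the following. (1) The Schurian association scheme of $G$ on $X$ is commutative, so that $\mathbb{C}^X=U_0\oplus U_1\oplus\cdots\oplus U_m$ is an orthogonal decomposition into pairwise non-isomorphic irreducible $\mathbb{C}[G]$-modules with $U_0=\mathbb{C}\boldsymbol{1}$. (2) At least one of the following holds: (i) for each $i\in\{0,1,\ldots,m\}$, $\operatorname{Im}(W_i^* )=U_0\oplus U_1\oplus\cdots\oplus U_i$; (ii) there exist scalars $\gamma_{i,j}\geq 0$ ($0\le i,j\le m$) such that $W_i^*W_i|_{U_j}=\gamma_{i,j}I$, with $\gamma_{i,j}>0$ for all $0\leq j\leq i$ and $\gamma_{i,j}=0$ for all $i<j\leq m$. (3) For every $i=t+1,t+2,\ldots,m$, $$A_i+\sum_{j=t+1}^{i-1}B_{i,j}\left(1-\lambda^{-1}A_j\right)<1,$$ where $A_i:=\dfrac{\gamma_{i,0}b_D}{|X|\alpha_i}$ and $B_{i,j}:=\dfrac{\lambda\alpha_j\gamma_{i,j}}{\alpha_i\gamma_{j,j}}$ for $t<j\leq i\leq m$. Then $$\operatorname{span}_{\mathbb{C}}\{g\boldsymbol{1}_D\mid g\in G\}=U_0\oplus U_{t+1}\oplus U_{t+2}\oplus\cdots\oplus U_m.$$ In particular, $$\dim_{\mathbb{Q}}\operatorname{span}_{\mathbb{Q}}\{g\boldsymbol{1}_D\mid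 g\in G\}=|X|-\sum_{j=1}^{t}\dim U_j.$$
   Context: Graded poset: a finite poset $\Omega$ with a rank function $\operatorname{rk}:\Omega\to\mathbb{N}$ such that $x\le y$ implies $\operatorname{rk}(x)\le\operatorname{rk}(y)$, and $\operatorname{rk}(y)=\operatorname{rk}(x)+1$ whenever $y$ covers $x$. Its rank is $m=\max\operatorname{rk}$, its $i$-th fiber is $X_i=\{x:\operatorname{rk}(x)=i\}$ (so $\Omega=X_0\sqcup\cdots\sqcup X_m$), and $X:=X_m$ is the top fiber. $G$-admissible graded poset: a finite graded poset $(\Omega,\le)$ of rank $m$ on which a finite group $G$ acts, such that: (1) for all $0\le i\le m$, the number $\alpha_i:=\#\{z\in X_i: z\le x\}$ does not depend on $x\in X_m$; (2) for all $0\le t<i\le m$ and every $z\in X_i$ there is at least one $y\in X_t$ with $y\le z$; (3) for all $z,x\in\Omega$, $g\in G$: $z\le x$ iff $gz\le gx$; (4) $G$ acts transitively on $X_m$. The Schurian association scheme of $G$ on $X$ is the association scheme whose relations are the orbits of $G$ on $X\times X$; it is commutative iff the permutation module $\mathbb{C}^X$ is multiplicity-free. It is assumed that the number of irreducible constituents is $m+1$, where $m$ is the rank of $\Omega$; they are labelled $U_0,\dots,U_m$. Orthogonality is for the standard Hermitian inner product on $\mathbb{C}^X$. $\boldsymbol{1}$ is the all-ones function. $G$ acts on $\mathbb{C}^X$ by permuting coordinates, so $g\boldsymbol{1}_D=\boldsymbol{1}_{gD}$. Incidence operator: $W_i:\mathbb{C}^X\to\mathbb{C}^{X_i}$, $(W_if)(z)=\sum_{x\in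 X,\,x\ge z}f(x)$; its adjoint is $(W_i^*h)(x)=\sum_{z\in X_i,\,z\le x}h(z)$. A $t$-design of index $\lambda$ in $X$ is a non-empty subset $D\subseteq X$ such that $\#\{x\in D: x\ge z\}=\lambda$ for every $z\in X_t$. $\boldsymbol{1}_D$ is its characteristic vector. Conditions (i) and (ii) in hypothesis (2) are equivalent in this setting; the $\gamma_{i,j}$ in hypothesis (3) are the scalars with $W_i^*W_i|_{U_j}=\gamma_{i,j}I$. *)

(* Defs.v *)
From mathcomp Require Import all_boot all_order all_fingroup all_algebra.
From mathcomp Require Import mxrepresentation spectral.

Set Implicit Arguments.
Unset Strict Implicit.
Unset Printing Implicit Defensive.

Import Order.TTheory GroupScope GRing.Theory Num.Theory.

(* Functions on a finite set [S] with values in a field [F] are row vectors   *)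
(* 'rV[F]_#|S|, the value at [enum_val k : S] being the [k]-th entry.          *)
(* Operators act on them by right multiplication; submodules are row spaces.  *)

Section PermutationModule.

Local Open Scope ring_scope.

Variables (gT : finGroupType) (G : {group gT}) (T : finType).
Variables (to : action G T) (S : {set T}).

Definition charvec (F : fieldType) (D : {set T}) : 'rV[F]_#|S| :=
  \row_(k < #|S|) (enum_val k \in D)%:R.

(* Actions are right actions, as everywhere in MathComp: [to x g] is the      *)
(* point [g x].  Row [k] is the image of the basis vector at [enum_val k].    *)
Definition permact_mx (F : fieldType) (g : gT) : 'M[F]_#|S| :=
  \matrix_(k < #|S|, l < #|S|) (to (enum_val k) g == enum_val l)%:R.

Hypothesis nSG : [acts G, on S | to].

Let to_in g (k : 'I_#|S|) : g \in G -> to (enum_val k) g \in S.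
Proof. by move=> Gg; rewrite (acts_act nSG Gg) enum_valP. Qed.

Lemma permact_mx_repr (F : fieldType) : mx_repr G (permact_mx F).
Proof.
split=> [|g h Gg Gh]; apply/matrixP=> k l; rewrite !mxE.
  by rewrite act1 (inj_eq enum_val_inj).
have [k' Dk'] : exists k' : 'I_#|S|, enum_val k' = to (enum_val k) g.
  by exists (enum_rank_in (to_in k Gg) (to (enum_val k) g));
     rewrite enum_rankK_in // to_in.
rewrite (bigD1 k') //= !mxE -Dk' eqxx mul1r big1 ?addr0.
  by rewrite Dk' actMin.
move=> j nej; rewrite !mxE -Dk'; case: eqP => [/enum_val_inj eqj|_].
  by rewrite eqj eqxx in nej.
by rewrite mul0r.
Qed.

Definition perm_repr (F : fieldType) : mx_representation F G #|S| :=
  MxRepresentation (permact_mx_repr F).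

Lemma charvec_act (F : fieldType) (D : {set T}) g :
  D \subset S -> g \in G ->
  charvec F D *m perm_repr F g = charvec F [set to x g | x in D].
Proof.
move=> sDS Gg; apply/rowP=> l; rewrite !mxE.
have [/imsetP[x Dx Dl]|nDl] := boolP (_ \in _).
  have [k Dk] : exists k : 'I_#|S|, enum_val k = x.
    have Sx := subsetP sDS x Dx.
    by exists (enum_rank_in Sx x); rewrite enum_rankK_in.
  rewrite (bigD1 k) //= !mxE Dk Dx Dl eqxx mul1r big1 ?addr0 // => j nej.
  rewrite !mxE Dl -Dk; case: eqP => [/act_inj/enum_val_inj eqj|_].
    by rewrite eqj eqxx in nej.
  by rewrite mulr0.
rewrite big1 // => k _; rewrite !mxE.
case: eqP => [Dk|_]; last by rewrite mulr0.
case: (boolP (enum_val k \in D)) => [Dx|_]; last by rewrite mul0r.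
by case/negP: nDl; rewrite -Dk; apply/imsetP; exists (enum_val k).
Qed.

(* The [F]-span of all [g 1_D] with [g] in [G].                               *)
Definition orbit_span (F : fieldType) (D : {set T}) : 'M[F]_#|S| :=
  (\sum_(g in G) <<charvec F D *m perm_repr F g>>)%MS.

End PermutationModule.

Section SchurianScheme.

Variables (gT : finGroupType) (G : {group gT}) (T : finType).
Variables (to : action G T) (S : {set T}).

Definition orbital (x y : T) : {set T * T} :=
  [set (to x g, to y g) | g in G].

Definition orbitals : {set {set T * T}} :=
  [set orbital x y | x in S, y in S].

Definition scheme_paths (P Q : {set T * T}) (x y : T) : nat :=
  #|[set z in S | ((x, z) \in P) && ((z, y) \in Q)]|.

(* The intersection numbers satisfy p_{P,Q}^R = p_{Q,P}^R; here [R] is the     *)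
(* orbital containing (x, y).                                                 *)
Definition commutative_scheme : Prop :=
  forall P Q, P \in orbitals -> Q \in orbitals ->
  {in S &, forall x y, scheme_paths P Q x y = scheme_paths Q P x y}.

End SchurianScheme.

Section GradedPoset.

Local Open Scope order_scope.

Variables (d : Order.disp_t) (Omega : finPOrderType d).

Definition covers (y x : Omega) : Prop :=
  x < y /\ forall z, ~~ ((x < z) && (z < y)).

Record graded (rk : Omega -> nat) (m : nat) : Prop := Graded {
  graded_le : forall x y, x <= y -> (rk x <= rk y)%N;
  graded_covers : forall x y, covers y x -> rk y = (rk x).+1;
  graded_rank : m = (\max_(x : Omega) rk x)%N
}.

Definition fiber (rk : Omega -> nat) (i : nat) : {set Omega} :=
  [set x | rk x == i].

Record admissible (gT : finGroupType) (G : {group gT}) (to : action G Omega)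
    (rk : Omega -> nat) (m : nat) (alpha : 'I_m.+1 -> nat) : Prop :=
  Admissible {
    admissible_graded : graded rk m;
    admissible_below : forall (i : 'I_m.+1) x, x \in fiber rk m ->
      #|[set z in fiber rk i | z <= x]| = alpha i;
    admissible_exists : forall s i z, (s < i)%N -> (i <= m)%N ->
      z \in fiber rk i -> exists2 y, y \in fiber rk s & y <= z;
    admissible_act : forall z x g, g \in G -> (z <= x) = (to z g <= to x g);
    admissible_trans : [transitive G, on fiber rk m | to]
  }.

Lemma admissible_acts gT (G : {group gT}) (to : action G Omega) rk m alpha :
  @admissible gT G to rk m alpha -> [acts G, on fiber rk m | to].
Proof. by case=> _ _ _ _; exact: atrans_acts_in. Qed.

Definition is_design (rk : Omega -> nat) (m t lambda : nat)
    (D : {set Omega}) : Prop :=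
  [/\ D \subset fiber rk m, D != set0 &
      {in fiber rk t, forall z, #|[set x in D | z <= x]| = lambda}].

End GradedPoset.

Section Incidence.

Local Open Scope ring_scope.

Variables (d : Order.disp_t) (Omega : finPOrderType d).
Variables (C : numClosedFieldType) (rk : Omega -> nat) (m : nat).

Local Notation X := (fiber rk m).

(* [f *m incidence i] is [W_i f] and [h *m incidence_adj i] is [W_i^* h].      *)
Definition incidence (i : nat) : 'M[C]_(#|X|, #|fiber rk i|) :=
  \matrix_(x < #|X|, z < #|fiber rk i|) (enum_val z <= enum_val x)%O%:R.

Definition incidence_adj (i : nat) : 'M[C]_(#|fiber rk i|, #|X|) :=
  \matrix_(z < #|fiber rk i|, x < #|X|) (enum_val z <= enum_val x)%O%:R.

Lemma incidenceE i (f : 'rV[C]_#|X|) z :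
  (f *m incidence i) 0 z =
  \sum_(x : 'I_#|X| | (enum_val z <= enum_val x)%O) f 0 x.
Proof.
rewrite !mxE [RHS]big_mkcond; apply: eq_bigr => x _; rewrite mxE.
by case: ifP; rewrite ?mulr1 ?mulr0.
Qed.

Lemma incidence_adjE i (h : 'rV[C]_#|fiber rk i|) x :
  (h *m incidence_adj i) 0 x =
  \sum_(z : 'I_#|fiber rk i| | (enum_val z <= enum_val x)%O) h 0 z.
Proof.
rewrite !mxE [RHS]big_mkcond; apply: eq_bigr => z _; rewrite mxE.
by case: ifP; rewrite ?mulr1 ?mulr0.
Qed.

Variable U : 'I_m.+1 -> 'M[C]_#|X|.

Definition images_filter : Prop :=
  forall i : 'I_m.+1,
    (incidence_adj i :=: \sum_(j < m.+1 | (j <= i)%N) U j)%MS.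

Definition incidence_scalars (gamma : 'I_m.+1 -> 'I_m.+1 -> C) : Prop :=
  forall (i j : 'I_m.+1) (f : 'rV[C]_#|X|), (f <= U j)%MS ->
    f *m incidence i *m incidence_adj i = gamma i j *: f.

Definition triangular_scalars : Prop :=
  exists gamma : 'I_m.+1 -> 'I_m.+1 -> C,
    [/\ forall i j, 0 <= gamma i j,
        incidence_scalars gamma,
        forall i j : 'I_m.+1, (j <= i)%N -> 0 < gamma i j &
        forall i j : 'I_m.+1, (i < j)%N -> gamma i j = 0].

End Incidence.

Section Decomposition.

Local Open Scope ring_scope.

Variables (C : numClosedFieldType) (gT : finGroupType) (G : {group gT}).
Variables (n m : nat) (rG : mx_representation C G n) (U : 'I_m.+1 -> 'M[C]_n).

Record irreducible_decomposition : Prop := IrreducibleDecomposition {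
  decomp_simple : forall j, mxsimple rG (U j);
  decomp_noniso : forall i j, i != j -> ~ mx_iso rG (U i) (U j);
  decomp_sum : (\sum_j U j :=: 1%:M)%MS;
  decomp_direct : mxdirect (\sum_j U j);
  decomp_orthogonal : forall i j (u v : 'rV[C]_n), i != j ->
    (u <= U i)%MS -> (v <= U j)%MS -> dotmx u v = 0;
  decomp_trivial : (U ord0 :=: (const_mx 1 : 'rV[C]_n))%MS
}.

End Decomposition.

Section Coefficients.

Local Open Scope ring_scope.

Variables (C : numClosedFieldType) (m : nat).
Variables (gamma : 'I_m.+1 -> 'I_m.+1 -> C) (alpha : 'I_m.+1 -> nat).

Definition design_A (cardD cardX : nat) (i : 'I_m.+1) : C :=
  gamma i ord0 * cardD%:R / (cardX%:R * (alpha i)%:R).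

Definition design_B (lambda : nat) (i j : 'I_m.+1) : C :=
  lambda%:R * (alpha j)%:R * gamma i j / ((alpha i)%:R * gamma j j).

End Coefficients.

(* Main.v *)
Require Import Defs.
From mathcomp Require Import all_boot all_order all_fingroup all_algebra.
From mathcomp Require Import pgroup mxrepresentation sesquilinear spectral ring.
From mathcomp Require Import complex reals.

Set Implicit Arguments.
Unset Strict Implicit.
Unset Printing Implicit Defensive.

Import Order.TTheory GRing.Theory Num.Theory.
Local Open Scope ring_scope.

(** Put [f = 1_D] and let [f_j] be its component in [U j].

    The span of the [g f] is the submodule generated by [f].  As the [U j] are
    simple and pairwise non-isomorphic, a submodule contains [U j] as soon as it
    has a nonzero component there ([multiplicity_free_sub], by Maschke and
    Schur).  The span is therefore the sum of the [U j] with [f_j != 0], and it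
    remains to find out which components of [f] vanish.

    The component [f_0] is the average of [f], with [|f_0|^2 = |D|^2 / |X|].
    The design property says that [W_t f] is constant, so that [W_t^* W_t f] lies
    in [U 0]; since [gamma t j > 0] for [j <= t], this kills [f_1, ..., f_t].

    For [i > t], look at [|W_i f|^2], which is both
    [\sum_j gamma i j * |f_j|^2] and [\sum_z c_z ^ 2], where [z] runs over the
    fiber [i] and [c_z] is the number of [x] in [D] with [z <= x].  The [c_z]
    are natural numbers, so [c_z <= c_z ^ 2]; they are at most [lambda], because
    [z] lies above some point of the fiber [t]; and double counting gives
    [\sum_z c_z = |D| alpha_i].  Hence
      [|D| alpha_i <= |W_i f|^2 <= lambda |D| alpha_i].
    The upper bound at [j > t] bounds [|f_j|^2] from above
    ([design_proj_norm_le]).  If [f_i] vanished, then inserting these bounds for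
    [t < j < i] into the lower bound at [i] ([design_norm_ge]) and dividing by
    [|D| alpha_i] would give
      [1 <= A_i + \sum_(t < j < i) B_ij (1 - lambda^-1 A_j)],
    against the assumed inequality ([design_proj_neq0]).

    The spanning vectors have entries 0 and 1, so the rank of their span is the
    same over the rationals as over the complex numbers, and the dimension
    formula is a count in the direct sum. *)

(** * Projections of a direct sum *)

Section DirectSumProjections.

Variables (F : fieldType) (n : nat) (I : finType) (U : I -> 'M[F]_n).

Definition summand_proj (j : I) : 'M[F]_n :=
  proj_mx (U j) (\sum_(i | i != j) U i)%MS.

Lemma summand_proj_sub k (A : 'M_(k, n)) j : (A *m summand_proj j <= U j)%MS.
Proof. exact: proj_mx_sub. Qed.

Hypothesis dxU : mxdirect (\sum_j U j).

Lemma summand_capmx0 j : (U j :&: \sum_(i | i != j) U i = 0)%MS.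
Proof. by move/mxdirect_sumsP: dxU => /(_ j isT). Qed.

Lemma summand_proj_id k (A : 'M_(k, n)) j :
  (A <= U j)%MS -> A *m summand_proj j = A.
Proof. exact/proj_mx_id/summand_capmx0. Qed.

Lemma summand_proj_0 k (A : 'M_(k, n)) i j :
  i != j -> (A <= U i)%MS -> A *m summand_proj j = 0.
Proof.
move=> ne_ij sAU; apply: proj_mx_0 (summand_capmx0 j) _.
exact: (sumsmx_sup i).
Qed.

Lemma mxrank_sub_direct (P : pred I) :
  \rank (\sum_(j | P j) U j)%MS = (\sum_(j | P j) \rank (U j))%N.
Proof.
suff /mxdirectP: mxdirect (\sum_(j | P j) U j) by [].
apply/mxdirect_sumsP => i Pi; apply/eqP.
rewrite -submx0 -[X in (_ <= X)%MS](summand_capmx0 i).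
apply: capmxS => //; apply/sumsmx_subP => j /andP[_ ne_ji].
exact: (sumsmx_sup j).
Qed.

Hypothesis sumU : (\sum_j U j :=: 1%:M)%MS.

Lemma sum_summand_proj k (A : 'M_(k, n)) : A = \sum_j A *m summand_proj j.
Proof.
have /sub_sumsmxP[u ->]: (A <= \sum_j U j)%MS by rewrite sumU submx1.
apply: eq_bigr => j _; rewrite mulmx_suml (bigD1 j) //=.
rewrite summand_proj_id ?submxMl //.
by rewrite big1 ?addr0 // => i ne_ij; rewrite (summand_proj_0 ne_ij) ?submxMl.
Qed.

End DirectSumProjections.

(** * Submodules of a multiplicity-free module *)

Section MultiplicityFree.

Import GroupScope.
Local Open Scope ring_scope.

Variables (F : fieldType) (gT : finGroupType) (G : {group gT}) (n : nat).
Variables (rG : mx_representation F G n) (I : finType) (U : I -> 'M[F]_n).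

Hypothesis simU : forall j, mxsimple rG (U j).
Hypothesis nonisoU : forall i j, i != j -> ~ mx_iso rG (U i) (U j).
Hypothesis sumU : (\sum_j U j :=: 1%:M)%MS.
Hypothesis dxU : mxdirect (\sum_j U j).

Lemma summand_proj_hom j k (A : 'M_(k, n)) :
  (A <= dom_hom_mx rG (summand_proj U j))%MS.
Proof.
apply: submx_trans (submx1 A) (submx_trans _ (proj_mx_hom _ _ _)).
- by rewrite -sumU (bigD1 j).
- exact: summand_capmx0.
- exact: mxsimple_module.
by apply: sumsmx_module => i _; apply: mxsimple_module.
Qed.

(** Schur's lemma for the projection onto [U j]. *)
Lemma simple_proj_iso S j :
  mxsimple rG S -> S *m summand_proj U j != 0 -> mx_iso rG S (U j).
Proof.
move=> simS nzS; apply: mx_Schur_iso (summand_proj_hom j S) _ nzS => //.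
exact: summand_proj_sub.
Qed.

(** The projection makes [S] isomorphic to [U j], hence to no other [U i], so
    its other components vanish and [S] lies inside the simple module [U j]. *)
Lemma simple_sub_summand S j :
  mxsimple rG S -> S *m summand_proj U j != 0 -> (U j <= S)%MS.
Proof.
move=> simS nzS; have isoSj := simple_proj_iso simS nzS.
have sSU: (S <= U j)%MS.
  rewrite (sum_summand_proj dxU sumU S) (bigD1 j) //= big1 ?addr0.
    exact: summand_proj_sub.
  move=> i ne_ij; apply/eqP/negPn/negP => /(simple_proj_iso simS) isoSi.
  exact: nonisoU ne_ij (mx_iso_trans (mx_iso_sym isoSi) isoSj).
by case: (simU j) => _ _; apply=> //; case: simS.
Qed.

(** By Maschke's theorem [M] is a sum of simple modules, one of which already
    has a nonzero component in [U j]. *)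
Lemma multiplicity_free_sub (M : 'M_n) j :
  [pchar F]^'.-group G -> mxmodule rG M ->
  M *m summand_proj U j != 0 -> (U j <= M)%MS.
Proof.
move=> charG modM nzM.
have redM := mx_reducibleS modM (submx1 M) (mx_Maschke_pchar rG charG).
apply: (mx_reducible_semisimple modM redM) => [[J S /= simS defM _]].
have [k nzS]: exists k, S k *m summand_proj U j != 0.
  apply/existsP; apply: contraNT nzM => /existsPn S0; rewrite -submx0.
  rewrite -(eqmxMr _ defM) sumsmxMr; apply/sumsmx_subP => k _.
  by rewrite submx0; apply/negPn/S0.
by rewrite -defM (sumsmx_sup k) // simple_sub_summand.
Qed.

End MultiplicityFree.

(** * The Hermitian product and orthogonal decompositions *)

Section Dot.

Variables (C : numClosedFieldType) (n : nat).
Implicit Types u v : 'rV[C]_n.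

Lemma dotmx_sumE u v : dotmx u v = \sum_k u 0 k * (v 0 k)^*.
Proof. by rewrite dotmxE mxE; apply: eq_bigr => k _; rewrite !mxE. Qed.

Lemma dotmx_ge0 u : 0 <= dotmx u u.
Proof. by rewrite dotmx_sumE sumr_ge0 // => k _; apply: mul_conjC_ge0. Qed.

Lemma dotmx_eq0 u : (dotmx u u == 0) = (u == 0).
Proof.
apply/idP/eqP => [|->]; last by rewrite linear0l.
by apply: contraTeq => /dotmx_is_dotmx /lt0r_neq0.
Qed.

Lemma dotmxZ a u : dotmx (a *: u) (a *: u) = a * a^* * dotmx u u.
Proof.
rewrite !dotmx_sumE mulr_sumr; apply: eq_bigr => k _; rewrite !mxE rmorphM /=.
by ring.
Qed.

End Dot.

Section OrthogonalDirectSum.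

Variables (C : numClosedFieldType) (n : nat) (I : finType) (U : I -> 'M[C]_n).
Hypothesis dxU : mxdirect (\sum_j U j).
Hypothesis sumU : (\sum_j U j :=: 1%:M)%MS.
Hypothesis orthoU : forall i j (u v : 'rV[C]_n), i != j ->
    (u <= U i)%MS -> (v <= U j)%MS -> dotmx u v = 0.
Local Notation proj := (summand_proj U).

(** Orthogonality makes the other components of [v] invisible to [u]. *)
Lemma dotmx_projl (u v : 'rV[C]_n) j :
  (u <= U j)%MS -> dotmx u (v *m proj j) = dotmx u v.
Proof.
move=> Uu; rewrite [v in RHS](sum_summand_proj dxU sumU) linear_sumr /=.
rewrite (bigD1 j) //= big1 ?addr0 // => i ne_ij.
by rewrite (@orthoU j i) 1?eq_sym ?summand_proj_sub.
Qed.

(** Parseval's identity weighted by an operator that is scalar on each summand;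
    orthogonality removes the cross terms. *)
Lemma dotmx_scalars (A : 'M[C]_n) (c : I -> C) (v : 'rV[C]_n) :
  (forall j (u : 'rV_n), (u <= U j)%MS -> u *m A = c j *: u) ->
  dotmx (v *m A) v = \sum_j c j * dotmx (v *m proj j) (v *m proj j).
Proof.
move=> Ac; rewrite {1}(sum_summand_proj dxU sumU v) mulmx_suml linear_sumlz /=.
apply: eq_bigr => j _; rewrite (Ac j) ?summand_proj_sub // linearZl_LR /=.
by rewrite dotmx_projl ?summand_proj_sub.
Qed.

Lemma mulmx_scalars_proj (A : 'M[C]_n) (c : I -> C) (v : 'rV[C]_n) j :
  (forall k (u : 'rV_n), (u <= U k)%MS -> u *m A = c k *: u) ->
  v *m A *m proj j = c j *: (v *m proj j).
Proof.
move=> Ac; rewrite {1}(sum_summand_proj dxU sumU v) !mulmx_suml (bigD1 j) //=.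
rewrite (Ac j) ?summand_proj_sub // -scalemxAl.
rewrite [_ *m proj j *m proj j](summand_proj_id dxU) ?summand_proj_sub //.
rewrite big1 ?addr0 // => k ne_kj; rewrite (Ac k) ?summand_proj_sub //.
by rewrite -scalemxAl (summand_proj_0 dxU ne_kj) ?scaler0 ?summand_proj_sub.
Qed.

End OrthogonalDirectSum.

(** * The scalars of the incidence operators *)

Section IncidenceTheory.

Variables (C : numClosedFieldType) (d : Order.disp_t) (Omega : finPOrderType d).
Variables (rk : Omega -> nat) (m : nat).
Local Notation X := (fiber rk m).
Local Notation W := (incidence C rk m).
Local Notation W' := (incidence_adj C rk m).

Lemma incidence_adjoint i (f : 'rV[C]_#|X|) (h : 'rV[C]_#|fiber rk i|) :
  dotmx (h *m W' i) f = dotmx h (f *m W i).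
Proof.
rewrite !dotmxE; congr (fun_of_matrix _ 0 0).
rewrite trmx_mul map_mxM mulmxA; congr (_ *m _ *m _).
by apply/matrixP=> x z; rewrite !mxE rmorph_nat.
Qed.

Variable U : 'I_m.+1 -> 'M[C]_#|X|.
Variable gamma : 'I_m.+1 -> 'I_m.+1 -> C.

Hypothesis nzU : forall j, U j != 0.
Hypothesis orthoU : forall i j (u v : 'rV[C]_#|X|), i != j ->
    (u <= U i)%MS -> (v <= U j)%MS -> dotmx u v = 0.
Hypothesis imW : images_filter U \/ triangular_scalars U.
Hypothesis gammaP : incidence_scalars U gamma.

Lemma incidence_norm (i j : 'I_m.+1) (u : 'rV[C]_#|X|) : (u <= U j)%MS ->
  dotmx (u *m W i) (u *m W i) = gamma i j * dotmx u u.
Proof.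
by move=> Uu; rewrite -incidence_adjoint (gammaP i Uu) linearZl_LR.
Qed.

Lemma scalar_ge0 (i j : 'I_m.+1) : 0 <= gamma i j.
Proof.
have /rowV0Pn[u Uu nzu] := nzU j.
by rewrite -(pmulr_lge0 _ (dotmx_is_dotmx nzu)) -(incidence_norm i Uu) dotmx_ge0.
Qed.

(** [gamma i j] is the ratio of [|W_i u|^2] to [|u|^2] for [u] in [U j]. *)
Lemma scalar_eq0P (i j : 'I_m.+1) :
  reflect (forall u : 'rV_#|X|, (u <= U j)%MS -> u *m W i = 0) (gamma i j == 0).
Proof.
apply: (iffP eqP) => [g0 u Uu | W0].
  by apply/eqP; rewrite -dotmx_eq0 (incidence_norm i Uu) g0 mul0r.
have /rowV0Pn[u Uu nzu] := nzU j.
apply: (mulIf (lt0r_neq0 (dotmx_is_dotmx nzu))).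
by rewrite -(incidence_norm i Uu) W0 // linear0l mul0r.
Qed.

(** If the images of the [W_i^*] filter the module, then [u <= U j] with
    [j <= i] is some [W_i^* h], so that [W_i u = 0] would give
    [|u|^2 = <h, W_i u> = 0].  Otherwise positivity is assumed for some family
    of scalars, which can only be [gamma]. *)
Lemma scalar_gt0 (i j : 'I_m.+1) : (j <= i)%N -> 0 < gamma i j.
Proof.
move=> le_ji; have /rowV0Pn[u Uu nzu] := nzU j.
case: imW => [imWi | [gamma' [_ gammaP' gamma'_gt0 _]]].
  rewrite lt_neqAle scalar_ge0 eq_sym andbT; apply/negP=> /scalar_eq0P W0.
  have /submxP[h Dh]: (u <= W' i)%MS by rewrite imWi (sumsmx_sup j).
  case/eqP: nzu; apply/eqP.
  by rewrite -dotmx_eq0 {1}Dh incidence_adjoint W0 ?linear0r.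
suff ->: gamma i j = gamma' i j by apply: gamma'_gt0.
apply: (mulIf (lt0r_neq0 (dotmx_is_dotmx nzu))).
rewrite -(incidence_norm i Uu) -incidence_adjoint (gammaP' i _ _ Uu).
by rewrite linearZl_LR.
Qed.

(** [|W_i u|^2 = <W_i^* W_i u, u>], where [W_i^* W_i u] lies in the sum of the
    [U k] with [k <= i], to which [U j] is orthogonal. *)
Lemma scalar_eq0 (i j : 'I_m.+1) : (i < j)%N -> gamma i j = 0.
Proof.
move=> lt_ij; apply/eqP/scalar_eq0P => u Uu.
case: imW => [imWi | [gamma' [_ gammaP' _ gamma'0]]]; apply/eqP.
  rewrite -dotmx_eq0 -incidence_adjoint.
  have /sub_sumsmxP[w ->]:
      (u *m W i *m W' i <= \sum_(k < m.+1 | (k <= i)%N) U k)%MS.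
    by rewrite -imWi submxMl.
  rewrite linear_sumlz big1 //= => k le_ki; apply: orthoU Uu; last exact: submxMl.
  by apply: contraTneq lt_ij => <-; rewrite -leqNgt.
rewrite -dotmx_eq0 -incidence_adjoint (gammaP' i _ _ Uu) gamma'0 // scale0r.
by rewrite linear0l.
Qed.

End IncidenceTheory.

(** * Counting the blocks above a point *)

Lemma sum_enum_val (T : finType) (R : nmodType) (A : {set T}) (F : T -> R) :
  \sum_(k < #|A|) F (enum_val k) = \sum_(x in A) F x.
Proof. by rewrite [RHS]big_enum_val. Qed.

Section BlockCounts.

Variables (d : Order.disp_t) (Omega : finPOrderType d) (gT : finGroupType).
Variables (G : {group gT}) (to : action G Omega).
Variables (rk : Omega -> nat) (m : nat) (alpha : 'I_m.+1 -> nat).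
Hypothesis adm : admissible to rk alpha.
Variables (t lambda : nat) (D : {set Omega}).
Hypothesis lt_tm : (t < m)%N.
Hypothesis designD : is_design rk m t lambda D.
Local Notation X := (fiber rk m).

Definition blocks_above z : nat := #|[set x in D | (z <= x)%O]|.

Lemma design_sub : D \subset X.
Proof. by case: designD. Qed.

Lemma design_card_gt0 : (0 < #|D|)%N.
Proof. by rewrite card_gt0; case: designD. Qed.

Lemma card_fiber_gt0 : (0 < #|X|)%N.
Proof. exact: leq_trans design_card_gt0 (subset_leq_card design_sub). Qed.

Lemma alpha_gt0 i : (0 < alpha i)%N.
Proof.
have [x Dx]: exists x, x \in D by apply/set0Pn; case: designD.
have Xx := subsetP design_sub x Dx.
rewrite -(admissible_below adm i Xx) card_gt0; apply/set0Pn.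
have [lt_im|] := ltnP i m; last first.
  rewrite leq_eqVlt ltnNge -ltnS ltn_ord orbF => /eqP <-.
  by exists x; rewrite inE Xx lexx.
have [y iy yx] := admissible_exists adm lt_im (leqnn m) Xx.
by exists y; rewrite inE iy.
Qed.

Lemma lambda_gt0 : (0 < lambda)%N.
Proof.
have [x Dx]: exists x, x \in D by apply/set0Pn; case: designD.
have Xx := subsetP design_sub x Dx.
have [y ty yx] := admissible_exists adm lt_tm (leqnn m) Xx.
case: designD => _ _ /(_ y ty) <-; rewrite card_gt0; apply/set0Pn.
by exists x; rewrite inE Dx.
Qed.

(** The blocks above [z] are also above any point of the fiber [t] below [z], and
    there are [lambda] of those. *)
Lemma blocks_above_le (i : 'I_m.+1) z :
  (t <= i)%N -> z \in fiber rk i -> (blocks_above z <= lambda)%N.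
Proof.
rewrite leq_eqVlt => /orP[/eqP <- | lt_ti] iz; case: designD => _ _ tD.
  by rewrite -(tD z).
have [y ty yz] := admissible_exists adm lt_ti (ltn_ord i) iz.
rewrite -(tD y ty) subset_leq_card //; apply/subsetP=> x.
by rewrite !inE => /andP[-> /(le_trans yz)].
Qed.

(** Count the pairs [z <= x] with [x] in [D] from both sides. *)
Lemma sum_blocks_above (i : 'I_m.+1) :
  (\sum_(z in fiber rk i) blocks_above z = #|D| * alpha i)%N.
Proof.
under eq_bigr => z _ do rewrite /blocks_above -sum1_card.
rewrite (exchange_big_dep (mem D)) /=; last first.
  by move=> z x _; rewrite inE => /andP[].
rewrite -sum_nat_const; apply: eq_bigr => x Dx.
rewrite -(admissible_below adm i (subsetP design_sub x Dx)) sum1_card.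
by apply: eq_card => z; rewrite unfold_in /= !inE Dx.
Qed.

(** A natural number is at most its square. *)
Lemma sum_blocks_above_sqr_ge (i : 'I_m.+1) :
  (#|D| * alpha i <= \sum_(z in fiber rk i) blocks_above z ^ 2)%N.
Proof.
rewrite -sum_blocks_above leq_sum // => z _.
by case: (blocks_above z) => // k; rewrite leq_pmulr.
Qed.

Lemma sum_blocks_above_sqr_le (i : 'I_m.+1) : (t <= i)%N ->
  (\sum_(z in fiber rk i) blocks_above z ^ 2 <= lambda * (#|D| * alpha i))%N.
Proof.
move=> le_ti; rewrite -sum_blocks_above big_distrr leq_sum //= => z iz.
by rewrite leq_mul2r (blocks_above_le le_ti) ?orbT.
Qed.

Variable C : numClosedFieldType.
Local Notation W := (incidence C rk m).
Local Notation W' := (incidence_adj C rk m).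
Local Notation f := (charvec X C D).
Local Notation one := (const_mx 1 : 'rV[C]_#|X|).

Lemma charvec_incidence i z :
  (f *m W i) 0 z = (blocks_above (enum_val z))%:R.
Proof.
rewrite incidenceE big_mkcond /=; under eq_bigr => x _ do rewrite mxE.
rewrite (sum_enum_val X
  (fun x => if (enum_val z <= x)%O then (x \in D)%:R else 0)).
rewrite /blocks_above -sum1_card natr_sum big_mkcond [RHS]big_mkcond /=.
apply: eq_bigr => x _; rewrite !inE; case: ifP => [_|].
  by case: (x \in D); case: (_ <= _)%O.
move=> nXx; rewrite ifN //.
by apply/negP=> /andP[/(subsetP design_sub)]; rewrite inE nXx.
Qed.

Lemma charvec_incidence_norm i :
  dotmx (f *m W i) (f *m W i) = (\sum_(z in fiber rk i) blocks_above z ^ 2)%:R.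
Proof.
rewrite dotmx_sumE natr_sum -[RHS]sum_enum_val; apply: eq_bigr => z _.
by rewrite charvec_incidence conjC_nat natrM.
Qed.

(** [W_t f] is the constant [lambda], and [W_t^*] maps the all-ones vector to
    [alpha_t] times itself. *)
Lemma design_normal_image :
  f *m W t *m W' t = (lambda * alpha (inord t))%:R *: one.
Proof.
apply/rowP=> x; rewrite incidence_adjE !mxE mulr1 big_mkcond /=.
under eq_bigr => z _ do rewrite charvec_incidence.
rewrite (sum_enum_val (fiber rk t)
  (fun z => if (z <= enum_val x)%O then (blocks_above z)%:R else 0)).
rewrite -big_mkcondr (eq_bigr (fun=> lambda%:R)).
  rewrite sumr_const -(admissible_below adm (inord t) (enum_valP x)) mulnC.
  rewrite natrM mulr_natl.
  rewrite inordK ?ltnS ?(ltnW lt_tm) //; congr (_ *+ _).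
  by apply: eq_card => z; rewrite [RHS]inE.
by move=> z /andP[tz _]; case: designD => _ _ /(_ z tz) <-.
Qed.

Lemma dotmx_one_charvec : dotmx one f = #|D|%:R.
Proof.
rewrite dotmx_sumE; under eq_bigr => k _ do rewrite !mxE conjC_nat mul1r.
rewrite (sum_enum_val X (fun x => (x \in D)%:R)) -sum1_card natr_sum.
rewrite big_mkcond [RHS]big_mkcond; apply: eq_bigr => x _.
by case: ifP => [_|]; case: ifP => // /(subsetP design_sub) ->.
Qed.

Lemma dotmx_one : dotmx one one = #|X|%:R.
Proof.
rewrite dotmx_sumE; under eq_bigr => k _ do rewrite !mxE conjC1 mulr1.
by rewrite sumr_const card_ord.
Qed.

End BlockCounts.

(** * The components of the characteristic vector of a design *)

Section DesignComponents.

Variables (d : Order.disp_t) (Omega : finPOrderType d) (gT : finGroupType).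
Variables (G : {group gT}) (to : action G Omega).
Variables (rk : Omega -> nat) (m : nat) (alpha : 'I_m.+1 -> nat).
Hypothesis adm : admissible to rk alpha.
Variables (t lambda : nat) (D : {set Omega}).
Hypothesis lt_tm : (t < m)%N.
Hypothesis designD : is_design rk m t lambda D.
Variable C : numClosedFieldType.
Local Notation X := (fiber rk m).
Variable U : 'I_m.+1 -> 'M[C]_#|X|.
Hypothesis decU : irreducible_decomposition (perm_repr (admissible_acts adm) C) U.
Hypothesis imW : images_filter U \/ triangular_scalars U.
Variable gamma : 'I_m.+1 -> 'I_m.+1 -> C.
Hypothesis gammaP : incidence_scalars U gamma.

Local Notation f := (charvec X C D).
Local Notation one := (const_mx 1 : 'rV[C]_#|X|).
Local Notation W := (incidence C rk m).
Local Notation W' := (incidence_adj C rk m).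
Local Notation proj := (summand_proj U).
Local Notation "'[ u ]" := (dotmx u u).

Let dxU := decomp_direct decU.
Let sumU := decomp_sum decU.
Let orthoU := decomp_orthogonal decU.

Let nzU j : U j != 0.
Proof. by case: (decomp_simple decU j). Qed.

Let one_sub : (one <= U ord0)%MS.
Proof. by rewrite (decomp_trivial decU). Qed.

Let incidence_mx_scalars (i j : 'I_m.+1) (u : 'rV_#|X|) :
  (u <= U j)%MS -> u *m (W i *m W' i) = gamma i j *: u.
Proof. by move=> Uu; rewrite mulmxA; apply: gammaP. Qed.

(** [W_t^* W_t] maps [f] to a constant vector, which has no component in [U j],
    and multiplies the component of [f] in [U j] by [gamma t j > 0]. *)
Lemma design_proj_eq0 (j : 'I_m.+1) : (0 < j <= t)%N -> f *m proj j = 0.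
Proof.
case/andP=> j_gt0 le_jt; pose i : 'I_m.+1 := inord t.
have Di : i = t :> nat by rewrite inordK // ltnS ltnW.
have g_gt0: 0 < gamma i j by apply: (scalar_gt0 nzU imW gammaP); rewrite Di.
have := mulmx_scalars_proj dxU sumU f j (@incidence_mx_scalars i).
rewrite mulmxA Di (design_normal_image adm lt_tm designD) -scalemxAl.
rewrite (summand_proj_0 dxU _ one_sub) ?scaler0; last first.
  by rewrite eq_sym -val_eqE /= -lt0n.
by move/esym/eqP; rewrite scaler_eq0 gt_eqF //= => /eqP.
Qed.

(** The component along the all-ones vector is the average [|D| / |X|] of [f]. *)
Lemma design_proj0_norm : '[f *m proj ord0] = #|D|%:R ^+ 2 / #|X|%:R.
Proof.
have nzX: #|X|%:R != 0 :> C by rewrite pnatr_eq0 -lt0n (card_fiber_gt0 designD).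
have /sub_rVP[a Da]: (f *m proj ord0 <= one)%MS.
  by rewrite -(decomp_trivial decU) summand_proj_sub.
have Dca: a^* = #|D|%:R / #|X|%:R.
  apply: (canRL (mulfK nzX)); rewrite -(dotmx_one_charvec designD).
  rewrite -(dotmx_projl dxU sumU orthoU _ one_sub) Da linearZr_LR /=.
  by rewrite dotmx_one.
have Daa: a = #|D|%:R / #|X|%:R.
  by rewrite -[a]conjCK Dca rmorphM fmorphV !rmorph_nat.
rewrite Da dotmxZ dotmx_one Dca Daa.
by field.
Qed.

Lemma incidence_norm_sum (i : 'I_m.+1) :
  '[f *m W i] = \sum_j gamma i j * '[f *m proj j].
Proof.
rewrite -(dotmx_scalars dxU sumU orthoU f (@incidence_mx_scalars i)).
by rewrite mulmxA incidence_adjoint.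
Qed.

(** Drop from [|W_j f|^2 <= lambda |D| alpha_j] the contributions of all
    components other than those in [U ord0] and [U j]; they are nonnegative. *)
Lemma design_proj_norm_le (j : 'I_m.+1) : (t < j)%N ->
  gamma j j * '[f *m proj j] <=
    lambda%:R * (#|D|%:R * (alpha j)%:R) - gamma j ord0 * '[f *m proj ord0].
Proof.
move=> lt_tj; rewrite lerBrDl.
have nz_j: j != ord0 by rewrite -val_eqE /= -lt0n (leq_ltn_trans _ lt_tj).
apply: le_trans (_ : '[f *m W j] <= _); last first.
  rewrite (charvec_incidence_norm designD) -!natrM ler_nat.
  exact: (sum_blocks_above_sqr_le adm designD (ltnW lt_tj)).
rewrite incidence_norm_sum (bigD1 ord0) //= (bigD1 j) //= addrA lerDl.
by apply: sumr_ge0 => k _; rewrite mulr_ge0 ?dotmx_ge0 ?(scalar_ge0 nzU gammaP).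
Qed.

(** The components [1, ..., t] of [f] vanish, that in [U i] is assumed to, and
    [gamma i j = 0] for [j > i]: only those listed contribute to [|W_i f|^2]. *)
Lemma design_norm_ge (i : 'I_m.+1) : (t < i)%N -> f *m proj i = 0 ->
  #|D|%:R * (alpha i)%:R <= gamma i ord0 * '[f *m proj ord0]
    + \sum_(j < m.+1 | (t < j < i)%N) gamma i j * '[f *m proj j].
Proof.
move=> lt_ti fi0; apply: le_trans (_ : '[f *m W i] <= _).
  rewrite (charvec_incidence_norm designD) -natrM ler_nat.
  exact: (sum_blocks_above_sqr_ge adm designD).
rewrite incidence_norm_sum (bigD1 ord0) //= lerD2l le_eqVlt; apply/orP; left.
apply/eqP; rewrite big_mkcond [RHS]big_mkcond; apply: eq_bigr => j _.
have [-> | nz_j] /= := eqVneq j ord0; first by [].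
have [le_jt | lt_tj] /= := leqP j t.
  by rewrite design_proj_eq0 ?linear0l ?mulr0 // le_jt lt0n andbT.
have [// | lt_ij | /val_inj ->] := ltngtP (j : nat) i.
  by rewrite (scalar_eq0 nzU orthoU imW gammaP) ?mul0r.
by rewrite fi0 linear0l mulr0.
Qed.

Hypothesis ineq : forall i : 'I_m.+1, (t < i)%N ->
  design_A gamma alpha #|D| #|X| i
    + \sum_(j < m.+1 | (t < j < i)%N) design_B gamma alpha lambda i j
        * (1 - lambda%:R^-1 * design_A gamma alpha #|D| #|X| j) < 1.

(** After multiplication by [|D| alpha_i], the left-hand side of the inequality
    is the bound of [design_norm_ge] with each [|f_j|^2] replaced by its upper
    bound from [design_proj_norm_le]. *)
Lemma design_proj_neq0 (i : 'I_m.+1) : (t < i)%N -> f *m proj i != 0.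
Proof.
move=> lt_ti; apply/eqP=> fi0; have := ineq lt_ti.
have b_gt0: 0 < #|D|%:R :> C by rewrite ltr0n (design_card_gt0 designD).
have X_gt0: 0 < #|X|%:R :> C by rewrite ltr0n (card_fiber_gt0 designD).
have a_gt0 k: 0 < (alpha k)%:R :> C by rewrite ltr0n (alpha_gt0 adm designD).
have l_gt0: 0 < lambda%:R :> C by rewrite ltr0n (lambda_gt0 adm lt_tm designD).
rewrite -(ltr_pM2l (mulr_gt0 b_gt0 (a_gt0 i))) mulr1 mulrDr mulr_sumr.
move/lt_le_trans/(_ (design_norm_ge lt_ti fi0))/lt_geF/negP; apply.
apply: lerD.
  rewrite design_proj0_norm /design_A le_eqVlt; apply/orP; left; apply/eqP.
  by field; rewrite ?(lt0r_neq0 X_gt0) ?(lt0r_neq0 (a_gt0 i)).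
apply: ler_sum => j /andP[lt_tj lt_ji].
have g_gt0: 0 < gamma j j by apply: (scalar_gt0 nzU imW gammaP).
have -> : gamma i j * '[f *m proj j]
    = gamma i j / gamma j j * (gamma j j * '[f *m proj j]).
  by field; rewrite lt0r_neq0.
have g_ge0 := ltW (divr_gt0 (scalar_gt0 nzU imW gammaP (ltnW lt_ji)) g_gt0).
apply: le_trans (ler_wpM2l g_ge0 (design_proj_norm_le lt_tj)) _.
rewrite design_proj0_norm /design_A /design_B le_eqVlt.
apply/orP; left; apply/eqP.
by field; rewrite ?(lt0r_neq0 X_gt0) ?(lt0r_neq0 (a_gt0 _)) ?lt0r_neq0.
Qed.

Lemma orbit_span_decomposition :
  (orbit_span (admissible_acts adm) C D
     :=: U ord0 + \sum_(j < m.+1 | (t < j)%N) U j)%MS.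
Proof.
set rG := perm_repr (admissible_acts adm) C; set M := orbit_span _ _ _.
have modU j: mxmodule rG (U j) := mxsimple_module (decomp_simple decU j).
have fM: (f <= M)%MS.
  by rewrite /M /orbit_span (sumsmx_sup 1%g) // genmxE repr_mx1 mulmx1.
have modM: mxmodule rG M.
  apply/mxmoduleP=> x Gx; rewrite sumsmxMr; apply/sumsmx_subP=> g Gg.
  rewrite (eqmxMr _ (genmxE _)) -mulmxA -repr_mxM //.
  by rewrite (sumsmx_sup (g * x)%g) ?groupM // genmxE.
have UM j: f *m proj j != 0 -> (U j <= M)%MS.
  move=> nz_fj; apply: multiplicity_free_sub modM _ => //.
  - exact: (decomp_simple decU).
  - exact: (decomp_noniso decU).
  - by rewrite /pgroup pcharf'_nat pnatr_eq0 -lt0n cardG_gt0.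
  by apply: contraNneq nz_fj => M0; rewrite -submx0 -M0 submxMr.
apply/eqmxP/andP; split.
  apply/sumsmx_subP=> g Gg; rewrite genmxE.
  set V := (_ + _)%MS; have /mxmoduleP modV: mxmodule rG V.
    by rewrite addsmx_module ?sumsmx_module.
  apply: submx_trans (modV g Gg); apply: submxMr.
  rewrite (sum_summand_proj dxU sumU f) summx_sub // => j _.
  have [-> | nz_j] := eqVneq j ord0.
    exact: submx_trans (summand_proj_sub _ _ _) (addsmxSl _ _).
  have [le_jt | lt_tj] := leqP j t.
    by rewrite design_proj_eq0 ?sub0mx // le_jt andbT lt0n.
  apply: submx_trans (addsmxSr _ _); rewrite (sumsmx_sup j) //.
  exact: summand_proj_sub.
rewrite addsmx_sub; apply/andP; split; last first.
  by apply/sumsmx_subP=> j lt_tj; apply/UM/design_proj_neq0.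
apply: UM; rewrite -dotmx_eq0 design_proj0_norm.
rewrite mulf_neq0 ?invr_neq0 ?expf_neq0 //.
  by rewrite pnatr_eq0 -lt0n (design_card_gt0 designD).
by rewrite pnatr_eq0 -lt0n (card_fiber_gt0 designD).
Qed.

End DesignComponents.

(** * Rank of the span over the rationals *)

Section RationalRank.

Variables (gT : finGroupType) (G : {group gT}) (T : finType).
Variables (to : action G T) (S : {set T}) (nSG : [acts G, on S | to]).

(** The generators have natural-number entries, which every field morphism
    preserves. *)
Lemma orbit_span_map (F F' : fieldType) (h : {rmorphism F -> F'}) D :
  (map_mx h (orbit_span nSG F D) :=: orbit_span nSG F' D)%MS.
Proof.
rewrite /orbit_span; elim/big_rec2: _ => [|g M' M _ eqM].
  by rewrite map_mx0.
apply: eqmx_trans (map_addsmx _ _ _) _; apply: adds_eqmx eqM.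
apply: eqmx_trans (map_genmx _ _) _; rewrite map_mxM.
suff [-> ->]: map_mx h (charvec S F D) = charvec S F' D
   /\ map_mx h (perm_repr nSG F g) = perm_repr nSG F' g by apply: eqmx_refl.
by split; apply/matrixP=> i j; rewrite !mxE rmorph_nat.
Qed.

Lemma mxrank_orbit_span (F : numFieldType) D :
  \rank (orbit_span nSG rat D) = \rank (orbit_span nSG F D).
Proof. by rewrite -(mxrank_map (@ratr F)) orbit_span_map. Qed.

End RationalRank.

(** * Span of the translates of a design *)

Local Open Scope complex_scope.

Theorem corollary3p9 (R : realType)
  (gT : finGroupType) (G : {group gT})
  (d : Order.disp_t) (Omega : finPOrderType d) (to : action G Omega)
  (rk : Omega -> nat) (m : nat) (alpha : 'I_m.+1 -> nat)
  (adm : admissible to rk alpha)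
  (t : nat) (lt_tm : (t < m)%N)
  (lambda : nat) (D : {set Omega}) (designD : is_design rk m t lambda D)
  (commX : commutative_scheme to (fiber rk m))
  (U : 'I_m.+1 -> 'M[R[i]]_#|fiber rk m|)
  (decU : irreducible_decomposition (perm_repr (admissible_acts adm) R[i]) U)
  (imW : images_filter U \/ triangular_scalars U)
  (gamma : 'I_m.+1 -> 'I_m.+1 -> R[i]) (gammaP : incidence_scalars U gamma)
  (ineq : forall i : 'I_m.+1, (t < i)%N ->
     let A := design_A gamma alpha #|D| #|fiber rk m| in
     let B := design_B gamma alpha lambda in
     A i + \sum_(j < m.+1 | (t < j < i)%N)
             B i j * (1 - lambda%:R^-1 * A j) < 1) :
  (orbit_span (admissible_acts adm) R[i] D
     :=: U ord0 + \sum_(j < m.+1 | (t < j)%N) U j)%MS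
  /\ (\rank (orbit_span (admissible_acts adm) rat D)
     = (#|fiber rk m| - \sum_(j < m.+1 | (1 <= j <= t)%N) \rank (U j))%N).
Proof.
have spanC := orbit_span_decomposition lt_tm designD decU imW gammaP ineq.
split=> //; rewrite (mxrank_orbit_span _ (R[i])) spanC.
pose P (j : 'I_m.+1) := (1 <= j <= t)%N.
have -> : (U ord0 + \sum_(j < m.+1 | (t < j)%N) U j)%MS
    = (\sum_(j | ~~ P j) U j)%MS.
  rewrite [RHS](bigD1 ord0) //=; congr (_ + _)%MS; apply: eq_bigl => j.
  rewrite /P negb_and -!ltnNge ltnS leqn0 -val_eqE /= andb_orl andbN /=.
  by case: eqP => [->|_]; rewrite ?ltn0 ?andbF ?andbT.
have dxU := decomp_direct decU.
rewrite (mxrank_sub_direct dxU) -[X in (X - _)%N](mxrank1 R[i]).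
rewrite -(decomp_sum decU) (mxrank_sub_direct dxU).
by rewrite [X in (X - _)%N](bigID P) /= addKn.
Qed.
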